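(* Let $\mathcal S=\mathcal S(\mathcal P_{\mathbf d},\mathcal X,\mathcal K)$ be a $K$-dimensional multi-degree spline space on $[a,b]$, with MDB-spline basis $N_1,\dots,N_K$, and let $N^{(1)}_1,\dots,N^{(1)}_{K-1}$ be the MDB-spline basis of the derivative space $D\mathcal S$. Then the Greville abscissae $\xi_1,\dots,\xi_K$ with respect to the basis $N_1,\dots,N_K$ of $\mathcal S$ are given by $$\xi_i=a+\sum_{j=1}^{i-1}\int_a^b N^{(1)}_j(x)\,dx,\qquad i=1,\dots,K.$$
   Context: **Multi-degree spline space.** Let $\mathcal X=\{x_i\}_{i=1}^q$ with $a=x_0<x_1<\dots<x_q<x_{q+1}=b$, $\mathbf d=(d_0,\dots,d_q)$ a vector of nonnegative integers, $\mathcal K=(k_1,\dots,k_q)$ a vector of nonnegative integers with $k_i\le\min\{d_{i-1},d_i\}$. $\mathcal S(\mathcal P_{\mathbf d},\mathcal X,\mathcal K)$ is the set of functions $f$ on $[a,b]$ for which there are polynomials $p_i$ of degree at most $d_i$, $i=0,\dots,q$, with $f=p_i$ on $[x_i,x_{i+1}]$ and $D^\ell p_{i-1}(x_i)=D^\ell p_i(x_i)$ for $\ell=0,\dots,k_i$, $i=1,\dots,q$. Its dimension is $K=d_0+1+\sum_{i=1}^q(d_i-k_i)$. **Extended partitions.** The left extended partition $\mathbf s=\{s_j\}_{j=1}^K$ lists $a$ repeated $d_0+1$ times, then $x_1$ repeated $d_1-k_1$ times, ..., then $x_q$ repeated $d_q-k_q$ times. The right extended partition $\mathbf t=\{t_j\}_{j=1}^K$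 lists $x_1$ repeated $d_0-k_1$ times, ..., $x_q$ repeated $d_{q-1}-k_q$ times, then $b$ repeated $d_q+1$ times. Put $s_{K+1}:=b$. **MDB-spline basis.** Let $m=\max_i d_i$. For $n=0,\dots,m$ and $i=m+1-n,\dots,K$, the function $N_{i,n}$ is supported on $[s_i,t_{i-m+n}]$ and, on each nontrivial breakpoint interval $[x_j,x_{j+1})\subset[s_i,t_{i-m+n}]$, is given by - $N_{i,n}(x)=1$ if $n=m-d_j$; - $N_{i,n}(x)=\int_{-\infty}^x\big[\delta_{i,n-1}N_{i,n-1}(u)-\delta_{i+1,n-1}N_{i+1,n-1}(u)\big]du$ if $n>m-d_j$; - $N_{i,n}(x)=0$ otherwise, where $\delta_{i,n}=\big(\int_{-\infty}^{+\infty}N_{i,n}(x)\,dx\big)^{-1}$. Functions $N_{i,n}$ that are undefined (index out of range, or $s_i\ge t_{i-m+n}$) are taken to be zero, and for them one sets $\int_{-\infty}^x\delta_{i,n}N_{i,n}(u)\,du:=0$ for $x<s_i$ and $:=1$ for $x\ge s_i$. Values at $b$ are taken as limits from the left. The MDB-spline basis of $\mathcal S$ is $N_i:=N_{i,m}$, $i=1,\dots,K$. It is known that these functions form a basis of $\mathcal S$, that $N_i$ vanishes outside $[s_i,t_i]$ and is positive on $(s_i,t_i)$, and that $\sum_iN_i=1$ on $[a,b]$. **Derivative space.** $D\mathcal S=\{D_+f: f\in\mathcal S\}$, where $D_+$ is the right derivative; it has dimension $K-1$ and is a piecewise (possibly discontinuous) spline space with associated degrees $d_i-1$ and continuities $k_i-1$,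 which may be negative; its restriction to $[x_i,x_{i+1}]$ is the zero function when $d_i-1<0$. Its (piecewise) MDB-spline basis is $N^{(1)}_i:=N_{i+1,m-1}$, $i=1,\dots,K-1$, with $N_{i,m-1}$ from the recurrence above for $\mathcal S$; it is relative to the extended partitions obtained by replacing $d_i,k_i$ with $d_i-1,k_i-1$. **Greville abscissae.** The Greville abscissae of $\mathcal S$ relative to the basis $N_1,\dots,N_K$ are the coefficients $\xi_1,\dots,\xi_K$ such that $\sum_{i=1}^K\xi_iN_i(x)=x$ for all $x\in[x_j,x_{j+1}]$ and all $j\in\{0,\dots,q\}$ such that $d_j\ge1$.
   Formalization: Formula for given Greville abscissae is proved when d_0≥1; that the formula's values are Greville abscissae is proved when no degree-0 interval precedes one of positive degree. Otherwise the claim fails (d=(0,1), k_1=0) or the abscissae do not exist or are not unique. *)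

(* Defs.v *)
From HB Require Import structures.
From mathcomp Require Import all_boot all_order all_algebra.
From mathcomp Require Import all_classical all_reals all_analysis.

Set Implicit Arguments.
Unset Strict Implicit.
Unset Printing Implicit Defensive.

Import Order.TTheory GRing.Theory Num.Theory.
Import numFieldNormedType.Exports.

Local Open Scope classical_set_scope.
Local Open Scope ring_scope.

(* A multi-degree spline space S(P_d, X, K) on [a, b] is given by its number q
   of interior breakpoints, its breakpoints a = x_0 < ... < x_(q+1) = b, its
   degrees d_0, ..., d_q and its continuity orders k_1, ..., k_q.  The
   sequences are total on nat; values outside these ranges are never used. *)
Record mdspline (R : realType) := MDSpline {
  nknots : nat;
  bp : nat -> R;
  deg : nat -> nat;
  cont : nat -> nat;
  bp_lt : forall i, (i <= nknots)%N -> bp i < bp i.+1;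
  cont_le : forall i, (1 <= i <= nknots)%N ->
    (cont i <= minn (deg i.-1) (deg i))%N }.

Definition left_end (R : realType) (S : mdspline R) : R := bp S 0.

Definition right_end (R : realType) (S : mdspline R) : R := bp S (nknots S).+1.

Definition md_dim (R : realType) (S : mdspline R) : nat :=
  (deg S 0).+1 + \sum_(1 <= i < (nknots S).+1) (deg S i - cont S i).

Definition max_deg (R : realType) (S : mdspline R) : nat :=
  \max_(j < (nknots S).+1) deg S j.

Definition left_partition (R : realType) (S : mdspline R) : seq R :=
  nseq (deg S 0).+1 (left_end S) ++
  flatten [seq nseq (deg S i - cont S i) (bp S i) | i <- iota 1 (nknots S)].

Definition right_partition (R : realType) (S : mdspline R) : seq R :=
  flatten [seq nseq (deg S i.-1 - cont S i) (bp S i) | i <- iota 1 (nknots S)]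
  ++ nseq (deg S (nknots S)).+1 (right_end S).

(* The entries s_j and t_j are numbered from 1.  The default value of nth
   yields the convention s_(K+1) = b. *)
Definition spt (R : realType) (S : mdspline R) (j : nat) : R :=
  nth (right_end S) (left_partition S) j.-1.

Definition tpt (R : realType) (S : mdspline R) (j : nat) : R :=
  nth (right_end S) (right_partition S) j.-1.

(* N_(i,n) is defined (and not just taken to be zero by convention) when
   m + 1 - n <= i <= K and s_i < t_(i-m+n). *)
Definition mdb_defined (R : realType) (S : mdspline R) (n i : nat) : bool :=
  [&& (max_deg S < i + n)%N, (i <= md_dim S)%N &
      spt S i < tpt S (i + n - max_deg S)].

Definition mdb_delta (R : realType) (f : R -> R) : R :=
  (\int[lebesgue_measure]_u f u)^-1.

(* x |-> \int_(-oo)^x delta_(i,n) N_(i,n), where f i stands for N_(i,n), with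
   its conventional value (a unit step at s_i) when N_(i,n) is undefined. *)
Definition mdb_cumul (R : realType) (S : mdspline R) (n : nat)
    (f : nat -> R -> R) (i : nat) (x : R) : R :=
  if mdb_defined S n i then
    \int[lebesgue_measure]_(u in `]-oo, x]) (mdb_delta (f i) * f i u)
  else if spt S i <= x then 1 else 0.

(* N_(i,n) away from b, where G i stands for
   x |-> \int_(-oo)^x delta_(i,n-1) N_(i,n-1). *)
Definition mdb_piece (R : realType) (S : mdspline R) (n : nat)
    (G : nat -> R -> R) (i : nat) (x : R) : R :=
  if [pick j : 'I_(nknots S).+1 | bp S j <= x < bp S j.+1] is Some j then
    if [&& mdb_defined S n i, spt S i <= bp S j &
           bp S j.+1 <= tpt S (i + n - max_deg S)] then
      if n == (max_deg S - deg S j)%N then 1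
      else if (max_deg S - deg S j < n)%N then G i x - G i.+1 x
      else 0
    else 0
  else 0.

Definition extend_left (R : realType) (b : R) (f : R -> R) (x : R) : R :=
  if x == b then lim (f @ b^'-) else f x.

(* For n = 0 the integral branch of mdb_piece is unreachable, so the family G
   is irrelevant. *)
Fixpoint mdb (R : realType) (S : mdspline R) (n : nat) : nat -> R -> R :=
  fun i => extend_left (right_end S)
    (mdb_piece S n
       (if n is n'.+1 then mdb_cumul S n' (mdb S n') else fun _ _ => 0) i).

Definition mdb_basis (R : realType) (S : mdspline R) (i : nat) : R -> R :=
  mdb S (max_deg S) i.

(* The basis N^(1)_i, 1 <= i <= K - 1, of the derivative space. *)
Definition mdb_deriv_basis (R : realType) (S : mdspline R) (i : nat) : R -> R :=
  mdb S (max_deg S).-1 i.+1.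

(* The coefficients xi_1, ..., xi_K are numbered from 1. *)
Definition greville_abscissae (R : realType) (S : mdspline R)
    (xi : nat -> R) : Prop :=
  forall j, (j <= nknots S)%N -> (1 <= deg S j)%N ->
  forall x, bp S j <= x <= bp S j.+1 ->
    \sum_(1 <= i < (md_dim S).+1) xi i * mdb_basis S i x = x.

(* Main.v *)
(* Write P_(i,n)(x) for the integral of delta_(i,n-1) N_(i,n-1) up to x, so that
   N_(i,n) = P_(i,n) - P_(i+1,n) on the intervals where level n is active.
   Summation by parts turns sum_i xi_i N_i into xi_1 + sum_i (xi_i - xi_(i-1))
   P_(i,m); for the xi_i of the theorem the differences cancel the factors
   delta_(i,m-1), and the partition of unity at level m - 1 makes the sum x.
   Conversely, differentiating sum_i xi_i N_i = x and using the linear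
   independence of the N_(i,m-1) determines the differences xi_i - xi_(i-1).

   All of this rests on the integral of N_(i,n) being nonzero whenever N_(i,n)
   is defined.  Lowering the smoothness by one at a single knot gives functions
   N'_(i,n) such that N_(i,n) = alpha_(i,n) N'_(i,n)
   + (1 - alpha_(i+1,n)) N'_(i+1,n).  Integrating this shows that the
   coefficients stay in [0, 1] from one level to the next, so positivity of the
   integrals is inherited from the totally discontinuous case, where the
   N_(i,n) are Bernstein polynomials on single intervals. *)

Require Import Defs.
From HB Require Import structures.
From mathcomp Require Import all_boot all_order all_algebra.
From mathcomp Require Import zify ring.
From mathcomp Require Import all_classical all_reals all_analysis.

Set Implicit Arguments.
Unset Strict Implicit.
Unset Printing Implicit Defensive.

Import Order.TTheory GRing.Theory Num.Theory.
Import numFieldNormedType.Exports.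

Local Open Scope ring_scope.

(** * Antiderivatives of piecewise polynomials *)

Section Antiderivative.
Variable R : numFieldType.
Implicit Types (p : {poly R}) (c : R).

Definition antideriv p : {poly R} :=
  \poly_(i < (size p).+1) (p`_i.-1 / i%:R).

(* For i = 0 both sides vanish, since 0^-1 = 0. *)
Lemma coef_antideriv p i : (antideriv p)`_i = p`_i.-1 / i%:R.
Proof.
rewrite coef_poly; case: ltnP => // si.
by rewrite nth_default ?mul0r //; case: i si.
Qed.

Lemma antideriv_is_linear : linear antideriv.
Proof.
move=> c p r; apply/polyP => i.
by rewrite !(coefD, coefZ, coef_antideriv) mulrDl mulrA.
Qed.
HB.instance Definition _ := GRing.isLinear.Build R {poly R} {poly R} *:%R
  antideriv antideriv_is_linear.

Lemma deriv_antideriv p : (antideriv p)^`() = p.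
Proof.
apply/polyP => i; rewrite coef_deriv coef_antideriv -[LHS]mulr_natr.
by rewrite divfK // pnatr_eq0.
Qed.

Lemma antideriv_deriv p : antideriv p^`() = p - (p.[0])%:P.
Proof.
apply/polyP => i; rewrite coefB coefC coef_antideriv horner_coef0.
case: i => [|i] /=; first by rewrite invr0 mulr0 subrr.
by rewrite coef_deriv -[p`_ _ *+ _]mulr_natr mulfK ?subr0 // pnatr_eq0.
Qed.

End Antiderivative.

Section PiecewisePolynomials.
Variables (R : numFieldType) (q : nat) (x : nat -> R).
Implicit Types (f g h : nat -> {poly R}) (c : R).

(* [f l] is the polynomial on [x_l, x_(l+1)], l = 0, ..., q; [cumul f j] is the
   restriction to [x_j, x_(j+1)] of the antiderivative that vanishes at x_0. *)
Definition mass f l := (antideriv (f l)).[x l.+1] - (antideriv (f l)).[x l].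

Definition total_mass f := \sum_(l < q.+1) mass f l.

Definition cumul f j : {poly R} :=
  (\sum_(l < j) mass f l - (antideriv (f j)).[x j])%:P + antideriv (f j).

Lemma mass0 f l : f l = 0 -> mass f l = 0.
Proof. by move=> fl; rewrite /mass fl raddf0 !horner0 subrr. Qed.

Lemma mass_lincomb c1 c2 f g h l : h l = c1 *: f l + c2 *: g l ->
  mass h l = c1 * mass f l + c2 * mass g l.
Proof. by move=> hl; rewrite /mass hl raddfD /= !linearZ /= !hornerE; ring. Qed.

Lemma mass_sum (I : Type) (r : seq I) (F : I -> nat -> {poly R}) l :
  mass (fun l' => \sum_(i <- r) F i l') l = \sum_(i <- r) mass (F i) l.
Proof.
rewrite /mass raddf_sum /= !horner_sum -sumrB; exact: eq_bigr.
Qed.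

Lemma mass1 f l : f l = 1 -> mass f l = x l.+1 - x l.
Proof.
move=> fl; have : antideriv (f l) = 'X.
  by rewrite fl -[1]derivX antideriv_deriv hornerX subr0.
by rewrite /mass => ->; rewrite !hornerX.
Qed.

Lemma total_mass_lincomb c1 c2 f g h :
  (forall l, (l <= q)%N -> h l = c1 *: f l + c2 *: g l) ->
  total_mass h = c1 * total_mass f + c2 * total_mass g.
Proof.
move=> hl; rewrite /total_mass !mulr_sumr -big_split /=.
by apply: eq_bigr => l _; apply: mass_lincomb; apply: hl; rewrite -ltnS.
Qed.

Lemma total_mass0 f : (forall l, (l <= q)%N -> f l = 0) -> total_mass f = 0.
Proof. by move=> f0; apply: big1 => l _; apply/mass0/f0; rewrite -ltnS. Qed.

Lemma cumul_lincomb c1 c2 f g h j :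
  (forall l, (l <= j)%N -> h l = c1 *: f l + c2 *: g l) ->
  cumul h j = c1 *: cumul f j + c2 *: cumul g j.
Proof.
move=> hl; rewrite /cumul (eq_bigr (fun l : 'I_j =>
  c1 * mass f l + c2 * mass g l)); last first.
  by move=> l _; apply: mass_lincomb; apply: hl; exact/ltnW.
have -> : antideriv (h j) = c1 *: antideriv (f j) + c2 *: antideriv (g j).
  by rewrite hl // linearD !linearZ.
rewrite big_split /= -!mulr_sumr hornerD !hornerZ -!mul_polyC.
by rewrite !(polyCB, polyCD, polyCM); ring.
Qed.

Lemma deriv_cumul f j : (cumul f j)^`() = f j.
Proof. by rewrite derivD derivC add0r deriv_antideriv. Qed.

Lemma cumul_knot f j : (cumul f j).[x j] = \sum_(l < j) mass f l.
Proof. by rewrite !hornerE /=; ring. Qed.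

Lemma cumul_before f j : (forall l, (l <= j)%N -> f l = 0) -> cumul f j = 0.
Proof.
move=> f0; rewrite /cumul f0 // raddf0 horner0 subr0 addr0.
by rewrite big1 // => l _; apply/mass0/f0/ltnW.
Qed.

Lemma cumul_after f j : (j <= q)%N ->
  (forall l, (j <= l <= q)%N -> f l = 0) -> cumul f j = (total_mass f)%:P.
Proof.
move=> jq f0; rewrite /cumul f0 ?leqnn // raddf0 horner0 subr0 addr0.
congr _%:P; rewrite /total_mass -(subnKC (leqW jq)) big_split_ord /=.
rewrite [X in _ + X]big1 ?addr0 // => l _; apply/mass0/f0.
by have := ltn_ord l; lia.
Qed.

End PiecewisePolynomials.

Lemma summation_by_parts (R : comNzRingType) (c : nat -> R)
    (F : nat -> {poly R}) K :
  \sum_(0 <= i < K.+1) c i *: (F i - F i.+1) =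
  c 0%N *: F 0%N + \sum_(1 <= i < K.+1) (c i - c i.-1) *: F i
    - c K *: F K.+1.
Proof.
elim: K => [|k IH]; first by rewrite big_nat1 big_geq // addr0 scalerBr.
rewrite big_nat_recr //= IH [in RHS]big_nat_recr //=.
by rewrite !scalerBr !scalerBl -!mul_polyC; ring.
Qed.

(** * The MDB recurrence on polynomial pieces *)

Section PolynomialModel.
Variables (R : realFieldType) (q m : nat) (x : nat -> R) (d : nat -> nat).
Implicit Types (nu : nat -> nat).

(* [nu j] and [scount nu j] stand for the numbers of entries of t and of s that
   are at most x_j; then [in_supp nu n i j] says that [x_j, x_(j+1)] lies in
   [s_i, t_(i-m+n)].  The last inequality of [valid_counts] says that k_(j+1)
   is at least -1, which allows discontinuities. *)
Definition scount nu j := (nu j + d j).+1.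

Definition valid_counts nu := forall j, (j < q)%N ->
  [/\ (nu j <= nu j.+1)%N, (scount nu j <= scount nu j.+1)%N &
      (nu j.+1 <= scount nu j)%N].

Definition in_supp nu n i j := (nu j + m < i + n)%N && (i <= scount nu j)%N.

(* [basis_cdf nu n i j] is the piece on [x_j, x_(j+1)] of the integral of
   delta_(i,n-1) N_(i,n-1), where an undefined N_(i,n-1) is recognized by its
   zero integral.  Starting from the step at s_i, differences also produce the
   value 1 at the levels n = m - d_j, so that case needs no special clause. *)
Fixpoint basis_cdf nu n i j : {poly R} :=
  if n is n'.+1 then
    let f l :=
      if (m <= n' + d l)%N then basis_cdf nu n' i l - basis_cdf nu n' i.+1 l
      else 0 in
    if total_mass q x f == 0 then (i <= scount nu j)%N%:R
    else (total_mass q x f)^-1 *: cumul x f j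
  else (i <= scount nu j)%N%:R.

Definition basis_piece nu n i j : {poly R} :=
  if (m <= n + d j)%N then basis_cdf nu n i j - basis_cdf nu n i.+1 j else 0.

Definition basis_integral nu n i := total_mass q x (basis_piece nu n i).

Lemma basis_cdfS nu n i j : basis_cdf nu n.+1 i j =
  if basis_integral nu n i == 0 then (i <= scount nu j)%N%:R
  else (basis_integral nu n i)^-1 *: cumul x (basis_piece nu n i) j.
Proof. by []. Qed.

Section Support.
Variable nu : nat -> nat.
Hypothesis nu_valid : valid_counts nu.

Lemma nu_homo l j : (l <= j)%N -> (j <= q)%N -> (nu l <= nu j)%N.
Proof.
elim: j => [|j IH]; first by rewrite leqn0 => /eqP->.
rewrite leq_eqVlt => /predU1P[->//|lj] jq.
by have [+ _ _] := nu_valid jq; apply: leq_trans; apply: IH => //; exact: ltnW.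
Qed.

Lemma scount_homo l j : (l <= j)%N -> (j <= q)%N ->
  (scount nu l <= scount nu j)%N.
Proof.
elim: j => [|j IH]; first by rewrite leqn0 => /eqP->.
rewrite leq_eqVlt => /predU1P[->//|lj] jq.
by have [_ + _] := nu_valid jq; apply: leq_trans; apply: IH => //; exact: ltnW.
Qed.

(** Off the support both cdfs are the same constant: 1 to the right, 0 to the left. Their values are
    hypotheses because the lemma also serves inside the induction that establishes them. *)
Lemma basis_piece_support_of n i j :
  ((i + n <= nu j + m + 1)%N -> (i <= scount nu j)%N ->
    basis_cdf nu n i j = 1) ->
  ((i.+1 + n <= nu j + m + 1)%N -> (i.+1 <= scount nu j)%N ->
    basis_cdf nu n i.+1 j = 1) ->
  ((scount nu j < i)%N -> basis_cdf nu n i j = 0) ->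
  ((scount nu j < i.+1)%N -> basis_cdf nu n i.+1 j = 0) ->
  ~~ in_supp nu n i j -> basis_piece nu n i j = 0.
Proof.
move=> one oneS zero zeroS.
rewrite /in_supp /basis_piece negb_and -leqNgt -ltnNge.
case: ifP => // act /orP[le|lt].
  by rewrite one ?oneS ?subrr // /scount; lia.
by rewrite zero // zeroS ?subrr //; exact: ltnW.
Qed.

(** Both claims go up together in n: once N_(i,n) vanishes off its support, its normalized integral
    is 0 before and 1 after it. A zero integral leaves the step, for which both claims are
    immediate. *)
Lemma basis_cdf_support n i j : (j <= q)%N ->
  ((i + n <= nu j + m + 1)%N -> (i <= scount nu j)%N ->
    basis_cdf nu n i j = 1) /\
  ((scount nu j < i)%N -> basis_cdf nu n i j = 0).
Proof.
elim: n i j => [|n IH] i j jq.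
  by split=> [_ /= ->//|/=]; rewrite ltnNge => /negbTE->.
have supp l : (l <= q)%N -> ~~ in_supp nu n i l -> basis_piece nu n i l = 0.
  move=> lq; have [? ?] := IH i l lq; have [? ?] := IH i.+1 l lq.
  exact: basis_piece_support_of.
rewrite basis_cdfS; case: eqVneq => [_|I0].
  by split=> [_ ->//|]; rewrite ltnNge => /negbTE->.
split=> [le _|lt].
  rewrite (cumul_after x jq) -/(basis_integral nu n i) => [|l /andP[jl lq]].
    by rewrite -mul_polyC -polyCM mulVf.
  by apply: supp => //; have := nu_homo jl lq; rewrite /in_supp; lia.
rewrite cumul_before ?scaler0 // => l lj; have lq := leq_trans lj jq.
by apply: supp => //; have := scount_homo lj jq; rewrite /in_supp; lia.
Qed.

Lemma basis_cdf_eq1 n i j : (j <= q)%N -> (i + n <= nu j + m + 1)%N ->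
  (i <= scount nu j)%N -> basis_cdf nu n i j = 1.
Proof. by move=> jq; have [] := basis_cdf_support n i jq. Qed.

Lemma basis_cdf_eq0 n i j : (j <= q)%N -> (scount nu j < i)%N ->
  basis_cdf nu n i j = 0.
Proof. by move=> jq; have [] := basis_cdf_support n i jq. Qed.

Lemma basis_piece_support n i j : (j <= q)%N -> ~~ in_supp nu n i j ->
  basis_piece nu n i j = 0.
Proof.
move=> jq; apply: basis_piece_support_of;
  (exact: basis_cdf_eq1 || exact: basis_cdf_eq0).
Qed.

Lemma basis_integral_eq0 n i : (forall j, (j <= q)%N -> ~~ in_supp nu n i j) ->
  basis_integral nu n i = 0.
Proof.
by move=> act; apply: total_mass0 => l lq; exact/basis_piece_support/act.
Qed.

(** Index 0 carries a zero piece, since n <= m. Starting there makes both boundary terms explicit: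
    the cdf is 1 at index 0 and 0 at index K.+1. *)
Lemma sum_basis_piece n (c : nat -> R) j K : (j <= q)%N -> (m <= n + d j)%N ->
  (n <= m)%N -> (scount nu j <= K)%N ->
  \sum_(0 <= i < K.+1) c i *: basis_piece nu n i j =
  (c 0%N)%:P + \sum_(1 <= i < K.+1) (c i - c i.-1) *: basis_cdf nu n i j.
Proof.
move=> jq act nm muK.
under eq_bigr do rewrite /basis_piece act.
rewrite (summation_by_parts c (fun i => basis_cdf nu n i j)).
rewrite [X in _ - _ *: X]basis_cdf_eq0 // scaler0 subr0.
rewrite basis_cdf_eq1 ?alg_polyC //; lia.
Qed.

Lemma sum_basis_piece1 n j K : (j <= q)%N -> (m <= n + d j)%N -> (n <= m)%N ->
  (scount nu j <= K)%N -> \sum_(0 <= i < K.+1) basis_piece nu n i j = 1.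
Proof.
move=> jq act nm muK.
rewrite (eq_bigr (fun i => 1 *: basis_piece nu n i j)) => [|i _]; last first.
  by rewrite scale1r.
rewrite (@sum_basis_piece n (fun=> 1)) // big1 ?addr0 // => i _.
by rewrite subrr scale0r.
Qed.

End Support.
End PolynomialModel.

(** * Positivity of the integrals *)

Section Positivity.
Variables (R : realFieldType) (q m : nat) (x : nat -> R) (d : nat -> nat).
Hypothesis d_le : forall j, (j <= q)%N -> (d j <= m)%N.
Implicit Types (nu : nat -> nat).

Local Notation mu := (scount d).
Local Notation valid_counts := (valid_counts q d).
Local Notation active := (in_supp m d).
Local Notation cdf := (basis_cdf q m x d).
Local Notation piece := (basis_piece q m x d).
Local Notation integral := (basis_integral q m x d).

Definition positive_integrals nu := forall n i j, (n <= m)%N -> (j <= q)%N ->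
  active nu n i j -> 0 < integral nu n i.

Lemma basis_integral_neq0 nu n i : valid_counts nu -> integral nu n i != 0 ->
  exists2 j, (j <= q)%N & active nu n i j.
Proof.
move=> nu_valid.
case: (boolP [exists j : 'I_q.+1, active nu n i j]) => [/existsP[j act] _|].
  by exists j => //; rewrite -ltnS.
move=> /existsPn inact /eqP[]; apply: basis_integral_eq0 => // j jq.
exact: (inact (Ordinal (jq : (j < q.+1)%N))).
Qed.

Lemma basis_integral_ge0 nu n i : (n <= m)%N -> valid_counts nu ->
  positive_integrals nu -> 0 <= integral nu n i.
Proof.
move=> nm nu_valid nu_pos; have [->//|] := eqVneq (integral nu n i) 0.
by move=> /(basis_integral_neq0 nu_valid)[j jq /(nu_pos _ _ _ nm jq)/ltW].
Qed.

(** Under positivity a zero integral forces zero pieces, so the factor delta cancels even where the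
    cdf is only a conventional step. *)
Lemma cumul_basis_piece nu n i j : valid_counts nu ->
  positive_integrals nu -> (n <= m)%N -> (j <= q)%N ->
  cumul x (piece nu n i) j = integral nu n i *: cdf nu n.+1 i j.
Proof.
move=> nu_valid nu_pos nm jq; rewrite basis_cdfS; case: eqVneq => [I0|I0].
  rewrite I0 scale0r cumul_before // => l lj; have lq := leq_trans lj jq.
  apply: basis_piece_support => //; apply/negP => /(nu_pos _ _ _ nm lq).
  by rewrite I0 ltxx.
by rewrite scalerA divff // scale1r.
Qed.

(** * Lowering the smoothness at one knot *)

Section Refinement.
Variables (nu : nat -> nat) (l0 : nat).

(* Replacing k_(l0) by k_(l0) - 1 inserts x_(l0) once into both s and t. *)
Definition lower_smoothness j := (nu j + (l0 <= j))%N.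
Local Notation nu' := lower_smoothness.

Lemma scount_refine j : mu nu' j = (mu nu j + (l0 <= j))%N.
Proof. by rewrite /scount /lower_smoothness; lia. Qed.

Hypothesis nu_valid : valid_counts nu.
Hypothesis l0_bounds : (0 < l0 <= q)%N.
Hypothesis smooth : (nu l0 < mu nu l0.-1)%N.

(** [smooth] says that k_(l0) is at least 0, so the lowered order is still at least -1. *)
Lemma lower_smoothness_valid : valid_counts nu'.
Proof.
move=> j jq; have [? ? ?] := nu_valid jq.
rewrite !scount_refine /lower_smoothness.
have E : (l0 <= j.+1)%N = (l0 <= j)%N || (j.+1 == l0) by lia.
split; rewrite ?E; try lia.
case: eqP => [jl|_]; last by lia.
by move: smooth; rewrite -jl /=; lia.
Qed.

Hypothesis lower_smoothness_pos : positive_integrals nu'.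

(* [a i] is alpha_(i,n); the thresholds say where N'_(i,n) lies on one side of
   the knot x_(l0). *)
Definition blend n (a : nat -> R) :=
  [/\ forall i, (i + n <= nu l0 + m + 1)%N -> a i = 1,
      forall i, (nu l0 + m + 1 < i + n)%N -> (mu nu l0.-1 < i)%N -> a i = 0,
      forall i, (i <= mu nu l0.-1)%N -> 0 < a i,
      forall i, (nu l0 + m + 1 < i + n)%N -> a i < 1 &
      forall i j, (j <= q)%N -> (m <= n + d j)%N ->
        cdf nu n i j = a i *: cdf nu' n i j + (1 - a i) *: cdf nu' n i.+1 j].

Lemma blend_itv n a i : blend n a -> 0 <= a i <= 1.
Proof.
case=> one zero pos lt1 _; have [le|lt] := leqP (i + n) (nu l0 + m + 1).
  by rewrite one // ler01 lexx.
rewrite (ltW (lt1 _ lt)) andbT.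
by have [/pos/ltW|/(zero _ lt)->] := leqP i (mu nu l0.-1).
Qed.

Lemma blend_piece n a i j : blend n a -> (j <= q)%N ->
  piece nu n i j = a i *: piece nu' n i j + (1 - a i.+1) *: piece nu' n i.+1 j.
Proof.
case=> _ _ _ _ blendP jq; rewrite /basis_piece.
case: ifP => [act|_]; last by rewrite !scaler0 addr0.
by rewrite !blendP // -!mul_polyC !polyCB polyC1; ring.
Qed.

Lemma blend_integral n a i : blend n a ->
  integral nu n i = a i * integral nu' n i
    + (1 - a i.+1) * integral nu' n i.+1.
Proof.
by move=> blendP; apply: total_mass_lincomb => l; apply: blend_piece.
Qed.

Lemma in_supp_lower_left n i j : (j < l0)%N ->
  active nu' n i j = active nu n i j.
Proof.
rewrite /in_supp scount_refine /lower_smoothness ltnNge => /negbTE->.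
by rewrite !addn0.
Qed.

Lemma in_supp_lower_right n i j : (l0 <= j)%N ->
  active nu' n i.+1 j = active nu n i j.
Proof. by rewrite /in_supp scount_refine /lower_smoothness => ->; lia. Qed.

Let l0q : (l0 <= q)%N. Proof. by case/andP: l0_bounds. Qed.

Let nu_l0 : (nu l0.-1 <= nu l0)%N.
Proof. by apply: (nu_homo nu_valid) => //; lia. Qed.

Let mu_l0 l : (l < l0)%N -> (mu nu l <= mu nu l0.-1)%N.
Proof. by move=> ll0; apply: (scount_homo nu_valid); lia. Qed.

(** Both terms are nonnegative. If the support ends by x_(l0), then a i = 1 and N'_(i,n) is active
    on interval j. Otherwise a i.+1 < 1 and N'_(i+1,n) is active on interval j, or on interval l0
    when j lies left of the knot. *)
Lemma blend_integral_gt0 n a i j : blend n a -> (n <= m)%N ->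
  (j <= q)%N -> active nu n i j -> 0 < integral nu n i.
Proof.
move=> blendP nm jq act; rewrite (blend_integral i blendP).
have I0 k :=
  basis_integral_ge0 k nm lower_smoothness_valid lower_smoothness_pos.
have /andP[a0 _] := blend_itv i blendP.
have /andP[_ a1] := blend_itv i.+1 blendP.
have [one _ _ lt1 _] := blendP.
have [le|lt] := leqP (i + n) (nu l0 + m).
  apply: ltr_wpDr; first by rewrite mulr_ge0 ?subr_ge0.
  rewrite one ?mul1r; last by lia.
  apply: (lower_smoothness_pos nm jq); rewrite in_supp_lower_left // ltnNge.
  apply/negP => l0j.
  by have := nu_homo nu_valid l0j jq; move: act; rewrite /in_supp; lia.
apply: ltr_wpDl; first by rewrite mulr_ge0.
rewrite mulr_gt0 ?subr_gt0 ?lt1 //; first by lia.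
have [l0j|jl0] := leqP l0 j.
  by apply: (lower_smoothness_pos nm jq); rewrite in_supp_lower_right.
apply: (lower_smoothness_pos nm l0q); rewrite in_supp_lower_right //.
have := scount_homo nu_valid (ltnW jl0) l0q.
by move: act; rewrite /in_supp; lia.
Qed.

(** At n = 0 the cdfs are steps and only intervals with d j = m count. Up to the threshold the same
    index gives the same step. Beyond it, the shift to i.+1 compensates the inserted entry right of
    the knot, and left of it both steps are 0. *)
Lemma blend0 : blend 0 (fun i => (i <= nu l0 + m + 1)%N%:R).
Proof.
have dm j (jq : (j <= q)%N) := d_le jq.
split=> [i|i|i|i|i j jq mdj] /=.
- by rewrite addn0 => ->.
- by rewrite addn0 ltnNge => /negbTE->.
- move=> le; suff -> : (i <= nu l0 + m + 1)%N by exact: ltr01.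
  have := dm l0.-1; move: le; rewrite /scount; lia.
- by rewrite addn0 ltnNge => /negbTE->; exact: ltr01.
have dj : d j = m by have := dm j jq; lia.
have -> : (i.+1 <= mu nu' j)%N = (i < mu nu j + (l0 <= j))%N.
  by rewrite scount_refine.
rewrite scount_refine; have [l0j|jl0] := leqP l0 j.
  have nuj := nu_homo nu_valid l0j jq.
  rewrite /scount dj; case: (leqP i (nu l0 + m + 1)) => li.
    rewrite scale1r subrr scale0r addr0; congr (_%:R).
    by congr nat_of_bool; lia.
  rewrite scale0r subr0 scale1r add0r; congr (_%:R).
  by congr nat_of_bool; lia.
have nuj := mu_l0 jl0.
have nuj' : (nu j <= nu l0)%N := nu_homo nu_valid (ltnW jl0) l0q.
case: (leqP i (nu l0 + m + 1)) => li.
  by rewrite scale1r subrr scale0r addr0 addn0.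
rewrite scale0r subr0 scale1r add0r; congr (_%:R).
by congr nat_of_bool; rewrite /scount dj; lia.
Qed.

(** The new coefficient is the share of N'_(i,n) in the integral of N_(i,n): dividing the integrated
    relation by that integral relates the normalized integrals, and by [blend_integral] the two
    shares add up to 1. For a zero integral the cdf is a step, and the coefficient 0 or 1 records
    which of the two refined steps equals it. *)
Lemma blendS n a : blend n a -> (n <= m)%N -> blend n.+1 (fun i =>
  if integral nu n i == 0 then (i + n <= nu l0 + m)%N%:R
  else a i * integral nu' n i / integral nu n i).
Proof.
move=> blendP nm; have [one zero pos lt1 _] := blendP.
have Igt0 i : integral nu n i != 0 -> 0 < integral nu n i.
  move=> /(basis_integral_neq0 nu_valid)[j jq].
  exact: blend_integral_gt0 blendP nm jq.
have inactive i : integral nu n i = 0 ->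
    forall j, (j <= q)%N -> ~~ active nu n i j.
  move=> I0 j jq; apply/negP => /(blend_integral_gt0 blendP nm jq).
  by rewrite I0 ltxx.
have compl i : integral nu n i != 0 ->
    1 - a i * integral nu' n i / integral nu n i =
    (1 - a i.+1) * integral nu' n i.+1 / integral nu n i.
  move=> I0; rewrite {1}(blend_integral i blendP) in I0 *.
  by rewrite (blend_integral i blendP); field.
have oneS i : integral nu n i != 0 -> (i + n <= nu l0 + m)%N ->
    a i * integral nu' n i / integral nu n i = 1.
  move=> I0 le; apply/eqP; rewrite -subr_eq0 -oppr_eq0 opprB subr_eq0.
  apply/eqP; move: (compl i I0); rewrite (one i.+1) ?subrr ?mul0r; last by lia.
  by move/eqP; rewrite subr_eq0 => /eqP.
split=> [i le|i lt mui|i le|i lt|i j jq mj].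
- have le' : (i + n <= nu l0 + m)%N by lia.
  by case: eqP => [_|/eqP/oneS->//]; rewrite le'.
- case: eqP => [_|_]; first by rewrite (_ : (_ <= _)%N = false) //; lia.
  have [lt'|le] := ltnP (nu l0 + m + 1) (i + n).
    by rewrite zero // !mul0r.
  rewrite [integral nu' n i]basis_integral_eq0 ?mulr0 ?mul0r //.
    exact: lower_smoothness_valid.
  move=> j jq; have [l0j|jl0] := leqP l0 j.
    have := nu_homo nu_valid l0j jq.
    by rewrite /in_supp /lower_smoothness l0j; lia.
  by rewrite in_supp_lower_left // /in_supp; have := mu_l0 jl0; lia.
- have [I0|I0] := eqVneq (integral nu n i) 0.
    rewrite (_ : (_ <= _)%N) ?ltr01 //.
    have /(inactive i I0) : (l0.-1 <= q)%N by lia.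
    by rewrite /in_supp le andbT; lia.
  have [/(oneS i I0)->|lt] := leqP (i + n) (nu l0 + m); first exact: ltr01.
  apply: divr_gt0 (Igt0 _ I0); apply: mulr_gt0; first exact: pos.
  have l0q' : (l0.-1 <= q)%N by lia.
  apply: (lower_smoothness_pos nm l0q').
  by rewrite in_supp_lower_left /in_supp; lia.
- have [I0|I0] := eqVneq (integral nu n i) 0.
    by rewrite (_ : (_ <= _)%N = false) ?ltr01 //; lia.
  rewrite -subr_gt0 compl //; apply: divr_gt0 (Igt0 _ I0).
  apply: mulr_gt0; first by rewrite subr_gt0 lt1; lia.
  have [l lq act] := basis_integral_neq0 nu_valid I0.
  have [l0l|ll0] := leqP l0 l.
    by apply: (lower_smoothness_pos nm lq); rewrite in_supp_lower_right.
  apply: (lower_smoothness_pos nm l0q); rewrite in_supp_lower_right //.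
  have := scount_homo nu_valid (ltnW ll0) l0q.
  by move: act; rewrite /in_supp; lia.
have [I0|I0] := eqVneq (integral nu n i) 0; last first.
  rewrite basis_cdfS (negbTE I0) compl //.
  rewrite (cumul_lincomb x (f := piece nu' n i) (g := piece nu' n i.+1)
    (c1 := a i) (c2 := 1 - a i.+1)) => [|l lj]; last first.
    by apply: blend_piece => //; exact: leq_trans jq.
  rewrite !cumul_basis_piece //; try exact: lower_smoothness_valid.
  by rewrite scalerDr !scalerA; congr (_ *: _ + _ *: _); ring.
(* The selected N' also has zero integral here, so two steps are compared. From the knot on, the
   first comparison relies on [mj]. *)
rewrite basis_cdfS I0 eqxx; have [le|lt] := leqP (i + n) (nu l0 + m).
  rewrite scale1r subrr scale0r addr0 basis_cdfS basis_integral_eq0 ?eqxx.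
  - congr (_%:R); congr nat_of_bool; rewrite scount_refine.
    have [l0j|_] := leqP l0 j; last by rewrite addn0.
    by have := nu_homo nu_valid l0j jq; rewrite /scount; lia.
  - exact: lower_smoothness_valid.
  move=> l lq; have [l0l|ll0] := leqP l0 l.
    have := nu_homo nu_valid l0l lq.
    by rewrite /in_supp /lower_smoothness l0l; lia.
  by rewrite in_supp_lower_left // inactive.
have mui : (mu nu l0.-1 < i)%N.
  have /(inactive i I0) : (l0.-1 <= q)%N by lia.
  by rewrite /in_supp; lia.
rewrite scale0r subr0 scale1r add0r basis_cdfS basis_integral_eq0 ?eqxx.
- congr (_%:R); congr nat_of_bool; rewrite scount_refine.
  have [l0j|jl0] := leqP l0 j; first by lia.
  by have := mu_l0 jl0; lia.
- exact: lower_smoothness_valid.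
move=> l lq; have [l0l|ll0] := leqP l0 l.
  by rewrite in_supp_lower_right // inactive.
by have := mu_l0 ll0; rewrite in_supp_lower_left // /in_supp; lia.
Qed.

Lemma positive_of_lower_smoothness : positive_integrals nu.
Proof.
have ex n : (n <= m)%N -> exists a, blend n a.
  elim: n => [|n IH] nm; first by eexists; exact: blend0.
  by have [a /blendS b] := IH (ltnW nm); eexists; apply/b/ltnW.
move=> n i j nm; have [a blendP] := ex n nm.
exact: blend_integral_gt0 blendP nm.
Qed.

End Refinement.
End Positivity.

(** * Bernstein polynomials *)

Section BernsteinTail.
Variables (R : realFieldType) (u : {poly R}).

(* The sum of the Bernstein polynomials 'C(r, l) u^(r - l) (1 - u)^l, l < k. *)
Fixpoint bernstein_tail (r k : nat) : {poly R} :=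
  match k, r with
  | 0, _ => 0
  | _.+1, 0 => 1
  | k'.+1, r'.+1 =>
    (1 - u) * bernstein_tail r' k' + u * bernstein_tail r' k'.+1
  end.

Lemma bernstein_tail0 r : bernstein_tail r 0 = 0.
Proof. by case: r. Qed.

Lemma bernstein_tail_full r k : (r < k)%N -> bernstein_tail r k = 1.
Proof.
elim: r k => [|r IH] [|k] //= rk; rewrite (IH k) ?(IH k.+1); try lia.
by ring.
Qed.

Lemma horner_bernstein_tail_at0 r k z : u.[z] = 0 ->
  (bernstein_tail r k).[z] = (r < k)%N%:R.
Proof.
move=> uz; elim: r k => [|r IH] [|k] /=; rewrite ?hornerC // !hornerE uz IH.
by rewrite subr0 mul1r mul0r addr0.
Qed.

Lemma horner_bernstein_tail_at1 r k z : u.[z] = 1 ->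
  (bernstein_tail r k).[z] = (0 < k)%N%:R.
Proof.
move=> uz; elim: r k => [|r IH] [|k] /=; rewrite ?hornerC // !hornerE uz !IH.
by rewrite subrr mul0r mul1r add0r.
Qed.

(** The derivatives of the summands telescope, and the difference on the right is the single
    polynomial 'C(r, k) u^(r - k) (1 - u)^k. *)
Lemma deriv_bernstein_tail r k : (bernstein_tail r.+1 k.+1)^`() =
  r.+1%:R * u^`() * (bernstein_tail r k.+1 - bernstein_tail r k).
Proof.
have E r' k' : bernstein_tail r'.+1 k'.+1 =
  (1 - u) * bernstein_tail r' k' + u * bernstein_tail r' k'.+1 by [].
have dE (p s : {poly R}) : ((1 - u) * p + u * s)^`() =
    u^`() * (s - p) + (1 - u) * p^`() + u * s^`().
  by rewrite !(derivD, derivM, derivN) derivC; ring.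
elim: r k => [|r IH] k; rewrite E dE.
  have d0 k' : (bernstein_tail 0 k')^`() = 0.
    by case: k' => [|k'] /=; exact: derivC.
  by rewrite !d0; ring.
rewrite IH; case: k => [|k].
  rewrite !bernstein_tail0 linear0 (E r 0%N) bernstein_tail0.
  by rewrite -[in RHS]natr1; ring.
by rewrite IH !E -[in RHS]natr1; ring.
Qed.

End BernsteinTail.

Section PositiveIntegrals.
Variables (R : realFieldType) (q m : nat) (x : nat -> R) (d : nat -> nat).
Hypothesis d_le : forall j, (j <= q)%N -> (d j <= m)%N.
Hypothesis x_lt : forall j, (j <= q)%N -> x j < x j.+1.
Implicit Types (nu : nat -> nat).

Local Notation mu := (scount d).
Local Notation valid_counts := (valid_counts q d).
Local Notation active := (in_supp m d).
Local Notation cdf := (basis_cdf q m x d).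
Local Notation piece := (basis_piece q m x d).
Local Notation integral := (basis_integral q m x d).
Local Notation positive_integrals := (positive_integrals q m x d).

(** * The totally discontinuous case: k = -1 at every knot *)

Section Discontinuous.
Variable nu : nat -> nat.
Hypothesis nu_valid : valid_counts nu.
Hypothesis nu_sep : forall j, (j < q)%N -> nu j.+1 = mu nu j.

(** By [nu_sep] the entries of s up to x_j have index at most nu l, so the corresponding supports
    end by x_l. *)
Lemma in_supp_disjoint n i j l : (n <= m)%N -> (j < l)%N -> (l <= q)%N ->
  active nu n i j -> ~~ active nu n i l.
Proof.
move=> nm jl lq; have := nu_homo nu_valid jl lq.
by rewrite nu_sep /in_supp ?(leq_trans jl) //; lia.
Qed.

Definition local_coord j : {poly R} := (x j.+1 - x j)^-1 *: ('X - (x j)%:P).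

(** The induction step of the Bernstein formula, with positivity as a by-product. N_(i,n) lives on
    interval j alone and is there c times the derivative of the next tail Q. Since Q rises from 0 to
    1, the integral is c and the normalized integral is Q. *)
Lemma local_cdf n i j : (n <= m)%N -> (j <= q)%N -> active nu n i j ->
    (forall i', (nu j + m < i' + n)%N -> (i' <= (mu nu j).+1)%N ->
      cdf nu n i' j =
      bernstein_tail (local_coord j) (n + d j - m) ((mu nu j).+1 - i')) ->
  0 < integral nu n i /\ cdf nu n.+1 i j =
    bernstein_tail (local_coord j) (n.+1 + d j - m) ((mu nu j).+1 - i).
Proof.
move=> nm jq act cdfE; have /andP[lei imu] := act.
have h0 : 0 < x j.+1 - x j by rewrite subr_gt0 x_lt.
have mnd : (m <= n + d j)%N by move: lei imu; rewrite /scount; lia.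
pose r := (n + d j - m)%N; pose k := (mu nu j - i)%N.
have -> : (n.+1 + d j - m = r.+1)%N by rewrite /r; lia.
have Ek : ((mu nu j).+1 - i = k.+1)%N by rewrite /k; lia.
rewrite Ek; set Q := bernstein_tail _ _ _.
(* The integral of a Bernstein polynomial of degree r over [x_j, x_(j+1)]. *)
pose c := (x j.+1 - x j) / r.+1%:R.
have c0 : 0 < c by rewrite divr_gt0 // ltr0n.
have QD : piece nu n i j = c *: Q^`().
  rewrite /basis_piece mnd !cdfE ?Ek; try by lia.
  have -> : ((mu nu j).+1 - i.+1 = k)%N by rewrite /k; lia.
  have uD : (local_coord j)^`() = ((x j.+1 - x j)^-1)%:P.
    by rewrite derivZ derivB derivX derivC subr0 alg_polyC.
  rewrite -/r deriv_bernstein_tail uD -polyC_natr -polyCM mul_polyC scalerA.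
  rewrite (_ : c * _ = 1) ?scale1r // /c.
  by field; rewrite (gt_eqF h0) nat1r pnatr_eq0.
have Qx : Q.[x j] = 0.
  rewrite horner_bernstein_tail_at0 /local_coord ?hornerE ?subrr ?mulr0 //.
  rewrite ltnS (_ : (_ < _)%N = false) //.
  by move: lei imu; rewrite /r /k /scount; lia.
have QxS : Q.[x j.+1] = 1.
  rewrite horner_bernstein_tail_at1 // /local_coord !hornerE /=.
  by rewrite mulVf // gt_eqF.
have other l : (l <= q)%N -> l != j -> piece nu n i l = 0.
  rewrite neq_ltn => lq /orP[lj|jl]; apply: basis_piece_support => //.
    by apply/negP => /(in_supp_disjoint nm lj jq); rewrite act.
  exact: in_supp_disjoint act.
clearbody Q.
have anti : antideriv (piece nu n i j) = c *: (Q - (Q.[0])%:P).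
  by rewrite QD linearZ /= antideriv_deriv.
have IE : integral nu n i = c.
  rewrite /basis_integral /total_mass.
  rewrite (bigD1 (Ordinal (jq : (j < q.+1)%N))) //= big1.
    rewrite addr0 /mass /= anti !hornerZ !hornerD !hornerN !hornerC.
    by rewrite QxS Qx; ring.
  by move=> l lj; apply/mass0/other => //; rewrite -ltnS.
split; first by rewrite IE.
rewrite basis_cdfS IE gt_eqF // /cumul big1 => [|l _]; last first.
  apply/mass0/other; last by rewrite ltn_eqF.
  exact: leq_trans (ltnW (ltn_ord l)) jq.
rewrite anti hornerZ hornerD hornerN hornerC Qx -!mul_polyC.
have cc : (c^-1)%:P * c%:P = 1 :> {poly R} by rewrite -polyCM mulVf ?gt_eqF.
transitivity ((c^-1)%:P * c%:P * Q); last by rewrite cc mul1r.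
by rewrite !(polyCB, polyCM, polyCN, polyCD) polyC0; ring.
Qed.

Lemma discontinuous_cdf n i j : (n <= m)%N -> (j <= q)%N ->
  (nu j + m < i + n)%N -> (i <= (mu nu j).+1)%N -> (m <= n + d j)%N ->
  cdf nu n i j =
    bernstein_tail (local_coord j) (n + d j - m) ((mu nu j).+1 - i).
Proof.
move=> nm jq + + +; elim: n i nm => [|n IH] i nm lei imu mnd.
  have dj := d_le jq; have -> : (0 + d j - m = 0)%N by lia.
  have [->|neq] := eqVneq i (mu nu j).+1.
    by rewrite subnn /= ltnn.
  have -> : ((mu nu j).+1 - i = 1)%N by move: lei imu neq; rewrite /scount; lia.
  by rewrite /= (_ : (_ <= _)%N) //; lia.
have [->|neq] := eqVneq i (mu nu j).+1.
  by rewrite subnn bernstein_tail0 basis_cdf_eq0.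
have imu' : (i <= mu nu j)%N by lia.
have [le|lt] := leqP (i + n) (nu j + m).
  rewrite basis_cdf_eq1 ?bernstein_tail_full //; last by lia.
  by move: le imu' lei; rewrite /scount; lia.
have act : active nu n i j by rewrite /in_supp lt.
have [//|_ ->//] := local_cdf (ltnW nm) jq act.
move=> i' lei' imu''; apply: IH => //; first exact: ltnW.
by move: lt imu'; rewrite /scount; lia.
Qed.

Lemma discontinuous_positive : positive_integrals nu.
Proof.
move=> n i j nm jq act; have [|//] := local_cdf nm jq act.
move=> i' ? ?; apply: discontinuous_cdf => //.
by move: act; rewrite /in_supp /scount; lia.
Qed.

End Discontinuous.

(** Induction on the sum of k_(l+1) + 1 over the knots: some k that is at least 0 is lowered by one,
    and at sum 0 every k is -1. *)
Lemma basis_integral_positive nu : valid_counts nu -> positive_integrals nu.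
Proof.
have [N] := ubnP (\sum_(l < q) (mu nu l - nu l.+1))%N.
elim: N nu => // N IH nu; rewrite ltnS => smN nu_valid.
case: (boolP [forall l : 'I_q, nu l.+1 == mu nu l]) => [/forallP sep|].
  by apply: discontinuous_positive => // j jq; exact/eqP/(sep (Ordinal jq)).
rewrite negb_forall => /existsP[l neq].
have smooth : (nu l.+1 < mu nu l)%N.
  by rewrite ltn_neqAle neq; have [] := nu_valid l (ltn_ord l).
have l_bounds : (0 < l.+1 <= q)%N by rewrite /= ltn_ord.
apply: (positive_of_lower_smoothness d_le nu_valid l_bounds smooth).
apply: IH; last exact: lower_smoothness_valid.
(* Only the summand at l changes: elsewhere its two counts grow by the same amount. *)
apply: leq_trans smN; rewrite (bigD1 l) //= [in ltnRHS](bigD1 l) //= -addSn.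
apply: leq_add.
  by rewrite scount_refine /lower_smoothness leqnn ltnn; move: smooth; lia.
apply: leq_sum => j jl; rewrite scount_refine /lower_smoothness.
have -> : (l < j.+1)%N = (l < j)%N; last by lia.
rewrite ltnS leq_eqVlt; case: eqP => // lj.
by move: jl; rewrite -(inj_eq val_inj) /= lj eqxx.
Qed.

End PositiveIntegrals.

(** * Linear independence and summation by parts *)

Lemma cumul_sum (R : numFieldType) (x : nat -> R) (I : Type) (r : seq I)
    (F : I -> nat -> {poly R}) j :
  cumul x (fun l => \sum_(i <- r) F i l) j = \sum_(i <- r) cumul x (F i) j.
Proof.
rewrite /cumul; under eq_bigr do rewrite mass_sum.
rewrite exchange_big /= linear_sum horner_sum -sumrB rmorph_sum /=.
by rewrite -big_split.
Qed.

Section GrevillePolynomials.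
Variables (R : realFieldType) (q m : nat) (x : nat -> R) (d nu : nat -> nat).
Hypothesis d_le : forall j, (j <= q)%N -> (d j <= m)%N.
Hypothesis x_lt : forall j, (j <= q)%N -> x j < x j.+1.

Local Notation mu := (scount d nu).
Local Notation active := (in_supp m d nu).
Local Notation cdf := (basis_cdf q m x d nu).
Local Notation piece := (basis_piece q m x d nu).
Local Notation integral := (basis_integral q m x d nu).

Hypothesis nu_valid : valid_counts q d nu.

Let K := mu q.

Let mu_K j : (j <= q)%N -> (mu j <= K)%N.
Proof. by move=> jq; apply: (scount_homo nu_valid). Qed.

Lemma basis_integral_gt0 n i j : (n <= m)%N -> (j <= q)%N -> active n i j ->
  0 < integral n i.
Proof. exact: (basis_integral_positive d_le x_lt nu_valid). Qed.

Lemma deriv_basis_cdf n i j :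
  (cdf n.+1 i j)^`() = (integral n i)^-1 *: piece n i j.
Proof.
rewrite basis_cdfS; case: eqP => [->|_]; last by rewrite derivZ deriv_cumul.
by rewrite invr0 scale0r -polyC_natr derivC.
Qed.

Lemma deriv_sum_basis_piece n (c : nat -> R) j : (j <= q)%N ->
  (m <= n.+1 + d j)%N -> (n < m)%N ->
  (\sum_(0 <= i < K.+1) c i *: piece n.+1 i j)^`() =
  \sum_(0 <= i < K.+1) ((c i - c i.-1) / integral n i) *: piece n i j.
Proof.
move=> jq mnd nm; rewrite sum_basis_piece //; last exact: mu_K.
(* The term of index 0 on the right drops out because 0.-1 = 0. *)
rewrite derivD derivC add0r linear_sum [RHS]big_nat_recl //=.
rewrite subrr mul0r scale0r add0r big_add1; apply: eq_bigr => i _.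
by rewrite derivZ deriv_basis_cdf scalerA.
Qed.

(** The active indices on an interval are consecutive, so e is constant on them. As the active
    pieces sum to 1, the vanishing sum is that constant. *)
Lemma eq0_of_locally_constant n (e : nat -> R) : (n <= m)%N ->
  (forall j, (j <= q)%N -> \sum_(0 <= i < K.+1) e i *: piece n i j = 0) ->
  (forall i j, (j <= q)%N -> active n i j -> active n i.+1 j ->
    e i.+1 = e i) ->
  forall i j, (j <= q)%N -> active n i j -> e i = 0.
Proof.
move=> nm sum0 step i j jq act.
have const k : active n k j -> e k = e (mu j).
  have [N] := ubnP (mu j - k); elim: N k => // N IHN k leN ak.
  have [->//|kmu] := eqVneq k (mu j).
  have akS : active n k.+1 j by move: ak kmu; rewrite /in_supp; lia.
  by rewrite -(step k j) // IHN //; move: ak akS leN; rewrite /in_supp; lia.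
rewrite const //; have := sum0 j jq.
rewrite (eq_bigr (fun k => e (mu j) *: piece n k j)) => [|k _]; last first.
  have [/const->//|inact] := boolP (active n k j).
  by rewrite basis_piece_support // !scaler0.
rewrite -scaler_sumr sum_basis_piece1 ?mu_K //; last first.
  by move: act; rewrite /in_supp /scount; lia.
by rewrite alg_polyC => /eqP; rewrite polyC_eq0 => /eqP.
Qed.

(** Differentiating the relation and applying independence one level down makes the coefficients
    locally constant. At n = 0 an interval has at most one active index. *)
Lemma basis_piece_independent n (e : nat -> R) : (n <= m)%N ->
  (forall j, (j <= q)%N -> \sum_(0 <= i < K.+1) e i *: piece n i j = 0) ->
  forall i j, (j <= q)%N -> active n i j -> e i = 0.
Proof.
elim: n e => [|n IH] e nm sum0; apply: eq0_of_locally_constant => // i j jq.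
  by have := d_le jq; rewrite /in_supp /scount; lia.
move=> act actS; have nm' := ltnW nm.
have actS' : active n i.+1 j by move: act actS; rewrite /in_supp; lia.
have /eqP : (e i.+1 - e i) / integral n i.+1 = 0.
  apply: (IH (fun i => (e i - e i.-1) / integral n i) nm' _ i.+1 j jq actS').
  move=> l lq; have [mnd|mnd] := leqP m (n + d l).
    by rewrite -deriv_sum_basis_piece ?sum0 ?linear0 //; lia.
  by apply: big1 => k _; rewrite /basis_piece leqNgt mnd scaler0.
by rewrite mulf_eq0 invr_eq0 subr_eq0 (gt_eqF (basis_integral_gt0 nm' jq actS'))
  orbF => /eqP.
Qed.

Hypothesis m_gt0 : (0 < m)%N.

(** At level m.-1 the pieces sum to 1 where d l > 0 and to 0 where d l = 0, so their antiderivative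
    is z - x 0 as long as no interval of degree zero has been crossed. The alternative z = x j
    serves the right end of an interval followed by one of degree zero. *)
Lemma sum_greville_piece (xi : nat -> R) j z : (j <= q)%N ->
  xi 0%N = x 0%N ->
  (forall i, (0 < i)%N -> xi i = xi i.-1 + integral m.-1 i) ->
  (forall l, (l < j)%N -> (0 < d l)%N) -> (0 < d j)%N || (z == x j) ->
  \sum_(0 <= i < K.+1) xi i * (piece m i j).[z] = z.
Proof.
move=> jq xi0 xiS d_gt0 z_j.
have mS : m.-1.+1 = m by rewrite prednK.
have sum1 l : (l <= q)%N -> \sum_(0 <= i < K.+1) piece m.-1 i l =
    if (0 < d l)%N then 1 else 0.
  move=> lq; case: ifP => dl.
    by apply: sum_basis_piece1; rewrite ?mu_K ?leq_pred //; lia.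
  by apply: big1 => i _; rewrite /basis_piece ifF //; lia.
have -> : \sum_(0 <= i < K.+1) xi i * (piece m i j).[z] =
    (\sum_(0 <= i < K.+1) xi i *: piece m i j).[z].
  by rewrite horner_sum; apply: eq_bigr => i _; rewrite hornerZ.
rewrite sum_basis_piece ?mu_K //; last by lia.
have -> : \sum_(1 <= i < K.+1) (xi i - xi i.-1) *: cdf m i j =
    cumul x (fun l => \sum_(0 <= i < K.+1) piece m.-1 i l) j.
  rewrite cumul_sum [RHS]big_nat_recl //.
  rewrite [X in _ = X + _]cumul_before => [|l lj].
    rewrite add0r big_add1; apply: eq_bigr => i _.
    rewrite xiS // addrC addKr cumul_basis_piece ?mS ?leq_pred //.
    exact: (basis_integral_positive d_le x_lt nu_valid).
  by rewrite basis_piece_support ?(leq_trans lj) // /in_supp; lia.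
rewrite xi0 hornerD hornerC /cumul hornerD hornerC.
have -> : \sum_(l < j) mass x (fun l => \sum_(0 <= i < K.+1) piece m.-1 i l) l =
    x j - x 0%N.
  rewrite -(telescope_sumr _ (leq0n j)) big_mkord; apply: eq_bigr => l _.
  by apply: mass1; rewrite sum1 ?d_gt0 // (leq_trans (ltnW (ltn_ord l))).
case/orP: z_j => [dj|/eqP->]; last by ring.
have -> : antideriv (\sum_(0 <= i < K.+1) piece m.-1 i j) = 'X.
  by rewrite sum1 // dj -[1]derivX antideriv_deriv hornerX subr0.
by rewrite !hornerX; ring.
Qed.

Hypothesis nu0 : nu 0%N = 0%N.
Hypothesis nu_smooth : forall j, (j < q)%N -> (nu j.+1 < mu j)%N.

(** The first x_j at or after s_i begins such an interval: [nu_smooth], or i > 1 when j = 0, keeps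
    it before the end of the support. *)
Lemma deriv_in_supp i : (1 < i <= K)%N ->
  exists2 j, (j <= q)%N & active m.-1 i j.
Proof.
move=> /andP[i1 iK].
have [|j imu min_j] := @ex_minnP (fun j => i <= mu j)%N; first by exists q.
have jq : (j <= q)%N := min_j q iK.
exists j => //; rewrite /in_supp imu andbT.
case: j => [|j] in imu min_j jq *; first by rewrite nu0; lia.
have : (mu j < i)%N by rewrite ltnNge; apply/negP => /min_j; rewrite ltnn.
have := nu_smooth jq; lia.
Qed.

Lemma greville_unique (c : nat -> R) : (0 < d 0)%N ->
  (forall j, (j <= q)%N -> (0 < d j)%N ->
    \sum_(0 <= i < K.+1) c i *: piece m i j = 'X) ->
  c 1%N = x 0%N /\
  forall i, (1 < i <= K)%N -> c i = c i.-1 + integral m.-1 i.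
Proof.
move=> d0 cX; have mS : m.-1.+1 = m by rewrite prednK.
have K0 : (0 < K)%N by [].
split.
  (* At x 0 the cdfs of index above 1 vanish while that of index 1 is 1, so the sum collapses to c 0
     + (c 1 - c 0). *)
  have := congr1 (horner^~ (x 0%N)) (cX 0%N (leq0n q) d0).
  rewrite hornerX sum_basis_piece ?mu_K //; last by lia.
  rewrite big_nat_recl // (basis_cdf_eq1 _ nu_valid) // ?nu0; last by lia.
  rewrite /= hornerD hornerC hornerD alg_polyC hornerC horner_sum.
  rewrite big1_seq => [<-|].
    by rewrite addr0; ring.
  move=> i /=; rewrite mem_index_iota => /andP[i0 iK].
  have [|j jq act] := @deriv_in_supp i.+1; first by lia.
  have := basis_integral_gt0 (leq_pred m) jq act.
  have := basis_cdfS q m x d nu m.-1 i.+1 0; rewrite mS => -> I0.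
  rewrite hornerZ gt_eqF // hornerZ cumul_knot.
  by rewrite big_ord0 !mulr0.
move=> i iK; have [j jq act] := deriv_in_supp iK.
have I0 := basis_integral_gt0 (leq_pred m) jq act.
suff /eqP : (c i - c i.-1) / integral m.-1 i - 1 = 0.
  rewrite subr_eq0 => /eqP E; rewrite -[integral _ _]mul1r -E divfK ?gt_eqF //.
  by rewrite addrC subrK.
pose e k := (c k - c k.-1) / integral m.-1 k - 1.
apply: (basis_piece_independent (e := e) (leq_pred m) _ jq act) => l lq.
(* At level m.-1 all pieces vanish on intervals of degree zero, so the relation holds everywhere
   although [cX] covers only d l > 0. *)
have [dl|dl] := posnP (d l).
  by apply: big1 => k _; rewrite /basis_piece ifF ?scaler0 //; lia.
under eq_bigr do rewrite scalerBl scale1r.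
rewrite sumrB sum_basis_piece1 ?mu_K ?leq_pred //; last by lia.
rewrite -deriv_sum_basis_piece //; try lia.
by rewrite mS cX // derivX subrr.
Qed.

End GrevillePolynomials.

Local Open Scope classical_set_scope.
Local Open Scope ring_scope.

(** * Lebesgue integrals of piecewise polynomials *)

Lemma integrable_disjoint_setU d (T : measurableType d) (R : realType)
    (mu : {measure set T -> \bar R}) (A B : set T) (f : T -> \bar R) :
  measurable A -> measurable B -> [disjoint A & B] ->
  mu.-integrable A f -> mu.-integrable B f -> mu.-integrable (A `|` B) f.
Proof.
move=> mA mB /disj_setPS AB /(integrable_mkcond _ mA) iA
  /(integrable_mkcond _ mB) iB.
apply/(integrable_mkcond _ (measurableU _ _ mA mB)).
apply: eq_integrable (integrableD measurableT iA iB) => // t _ /=.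
rewrite !patchE in_setU.
have [tA|tA] := boolP (t \in A); have [tB|tB] := boolP (t \in B) => /=.
- by have := AB t; case; split; exact: set_mem.
- by rewrite adde0.
- by rewrite add0e.
- by rewrite adde0.
Qed.

Section PolynomialIntegral.
Variable R : realType.
Implicit Types p : {poly R}.
Local Notation leb := (@lebesgue_measure R).

Lemma integrable_horner p a b :
  leb.-integrable `[a, b[ (EFin \o horner p).
Proof.
apply: (@integrableS _ _ _ leb `[a, b]%classic) => //.
  by apply: subset_itvl; rewrite bnd_simp.
apply: continuous_compact_integrable; first exact: segment_compact.
exact/continuous_subspaceT/continuous_horner.
Qed.

Lemma Rintegral_horner p a b : a <= b ->
  \int[leb]_(u in `[a, b[) p.[u] = (antideriv p).[b] - (antideriv p).[a].
Proof.
rewrite le_eqVlt => /predU1P[->|ab].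
  by rewrite set_itvco0 Rintegral_set0 subrr.
rewrite Rintegral_itv_bndo_bndc; last exact: integrable_horner.
have cont q (z : R) : horner q y @[y --> z] --> horner q z.
  exact: continuous_horner.
rewrite /Rintegral (@continuous_FTC2 _ (horner p) (horner (antideriv p))) //.
- exact/continuous_subspaceT/continuous_horner.
- split=> [z _||]; first exact: derivable_horner.
  + exact/cvg_at_right_filter/cont.
  + exact/cvg_at_left_filter/cont.
- by move=> z _; rewrite -derivE deriv_antideriv.
Qed.

Section Piecewise.
Variables (q : nat) (x : nat -> R) (f : R -> R) (F : nat -> {poly R}).
Hypothesis x_lt : forall j, (j <= q)%N -> x j < x j.+1.
Hypothesis f_left : forall u, u < x 0%N -> f u = 0.
Hypothesis f_piece : forall j u, (j <= q)%N -> x j <= u < x j.+1 ->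
  f u = (F j).[u].
Hypothesis f_right : forall u, x q.+1 < u -> f u = 0.

Lemma piecewise_integral_extend j z : (j <= q)%N -> x j <= z <= x j.+1 ->
  leb.-integrable `]-oo, x j[ (EFin \o f) ->
  \int[leb]_(u in `]-oo, x j[) f u = \sum_(l < j) mass x F l ->
  leb.-integrable `]-oo, z[ (EFin \o f) /\
  \int[leb]_(u in `]-oo, z[) f u = (cumul x F j).[z].
Proof.
move=> jq /andP[xz zx] fj intj.
have E : `]-oo, z[%classic = `]-oo, x j[ `|` `[x j, z[ :> set R.
  by rewrite -itv_bndbnd_setU.
have dis : [disjoint (`]-oo, x j[%classic : set R) & `[x j, z[%classic].
  apply/disj_setPS => u [] /=; rewrite !in_itv /= => ux /andP[xu _].
  by move: xu; rewrite leNgt ux.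
have fF : {in `[x j, z[%classic, f =1 horner (F j)}.
  move=> u; rewrite inE /= in_itv /= => /andP[xu uz].
  by apply: f_piece => //; rewrite xu (lt_le_trans uz).
have iz : leb.-integrable `[x j, z[ (EFin \o f).
  apply: eq_integrable (integrable_horner (F j) (x j) z) => //.
  by move=> u uz /=; rewrite fF.
split; first by rewrite E; apply: integrable_disjoint_setU.
rewrite E Rintegral_setU //; last exact: integrable_disjoint_setU.
have -> : \int[leb]_(u in `[x j, z[) f u = \int[leb]_(u in `[x j, z[) (F j).[u].
  exact: eq_Rintegral.
rewrite intj Rintegral_horner //.
by rewrite /cumul hornerD hornerC addrAC addrA.
Qed.

Lemma piecewise_integral_open j z : (j <= q)%N -> x j <= z <= x j.+1 ->
  leb.-integrable `]-oo, z[ (EFin \o f) /\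
  \int[leb]_(u in `]-oo, z[) f u = (cumul x F j).[z].
Proof.
move=> jq zj; suff [fj intj] : leb.-integrable `]-oo, x j[ (EFin \o f) /\
    \int[leb]_(u in `]-oo, x j[) f u = \sum_(l < j) mass x F l.
  exact: piecewise_integral_extend.
elim: j {z zj} jq => [|j IH] jq.
  have f0 : {in `]-oo, x 0%N[%classic, f =1 cst 0}.
    by move=> u; rewrite inE /= in_itv /=; exact: f_left.
  split; last first.
    rewrite big_ord0 -[RHS](mul0r (fine (leb `]-oo, x 0%N[%classic))).
    by rewrite -Rintegral_cst //; apply: eq_Rintegral.
  by apply: eq_integrable (integrable0 _ _) => // u /f0 /= ->.
have [fj intj] := IH (ltnW jq).
have xj : x j <= x j.+1 <= x j.+1 by rewrite lexx andbT ltW // x_lt // ltnW.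
have [? ->] := piecewise_integral_extend (ltnW jq) xj fj intj; split => //.
rewrite /cumul hornerD hornerC big_ord_recr /= /mass addrAC.
by rewrite addrA.
Qed.

Lemma piecewise_integral j z : (j <= q)%N -> x j <= z <= x j.+1 ->
  \int[leb]_(u in `]-oo, z]) f u = (cumul x F j).[z].
Proof.
move=> jq zj; have [iz <-] := piecewise_integral_open jq zj.
by rewrite Rintegral_itv_bndo_bndc.
Qed.

Lemma cumul_right_end : (cumul x F q).[x q.+1] = total_mass q x F.
Proof.
by rewrite /cumul hornerD hornerC /total_mass big_ord_recr /= /mass; ring.
Qed.

Lemma piecewise_integral_total : \int[leb]_u f u = total_mass q x F.
Proof.
rewrite -cumul_right_end -piecewise_integral //; last first.
  by rewrite lexx andbT ltW // x_lt.
rewrite [RHS]Rintegral_mkcond; apply: eq_Rintegral => u _.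
rewrite patchE; case: ifPn => //; rewrite notin_setE /= in_itv /= => /negP.
by rewrite -ltNge => /f_right.
Qed.

Lemma piecewise_integral_itv :
  \int[leb]_(u in `[x 0%N, x q.+1]) f u = total_mass q x F.
Proof.
rewrite -piecewise_integral_total [LHS]Rintegral_mkcond.
apply: eq_Rintegral => u _; rewrite patchE; case: ifPn => //.
rewrite notin_setE /= in_itv /= => /negP; rewrite negb_and -!ltNge.
by case/orP => [/f_left|/f_right].
Qed.

End Piecewise.
End PolynomialIntegral.

(** * The functions N_(i,n) and their polynomial pieces *)

(** With P of the form u <= x_j or u < x_j, this turns comparing an entry of an extended partition
    with a breakpoint into counting multiplicities. As b fails P, indices past the end are
    covered. *)
Lemma nth_flatten_nseq (T : Type) (P : pred T) (c : nat -> nat) (y : nat -> T)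
    (b : T) J a n k :
  (forall l, (a <= l < a + n)%N -> P (y l) = (l < J)%N) -> ~~ P b ->
  (a <= J <= a + n)%N ->
  P (nth b (flatten [seq nseq (c l) (y l) | l <- iota a n]) k) =
  (k < \sum_(a <= l < J) c l)%N.
Proof.
move=> + Pb; elim: n a J k => [|n IH] a J k Py aJ.
  by rewrite nth_nil (negbTE Pb) big_geq // -[a]addn0; case/andP: aJ.
rewrite /= nth_cat size_nseq; case: ltnP => kc.
  rewrite nth_nseq kc Py ?leqnn ?addnS ?ltnS ?leq_addr //.
  case: ltnP => aJ'; last by rewrite big_geq.
  by rewrite big_ltn // ltn_addr.
have Py' l : (a < l < a.+1 + n)%N -> P (y l) = (l < J)%N.
  by move=> /andP[al ln]; apply: Py; rewrite (ltnW al) addnS.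
have [aJ'|Ja] := ltnP a J.
  have aJS : (a < J <= a.+1 + n)%N by rewrite aJ' addSnnS; case/andP: aJ.
  by rewrite (IH _ _ _ Py' aJS) ltn_subLR // [in RHS]big_ltn.
have Pa l : (a < l < a.+1 + n)%N -> P (y l) = (l < a.+1)%N.
  move=> al; rewrite Py' //; case/andP: al => al _.
  by rewrite ltnNge (leq_trans Ja (ltnW al)) ltnNge al.
by rewrite (IH _ _ _ Pa) ?leqnn ?leq_addr // !big_geq.
Qed.

Lemma poly_eq_on_itv (R : realFieldType) (p r : {poly R}) (a b : R) : a < b ->
  (forall u, a <= u < b -> p.[u] = r.[u]) -> p = r.
Proof.
move=> ab pr; apply/eqP; rewrite -subr_eq0; apply/negPn/negP => nz.
pose N := size (p - r).
(* Equally spaced points of [a, b), one more than the degree of p - r. *)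
pose s := [seq a + (b - a) * (k%:R / N.+1%:R) | k <- iota 0 N].
have := @max_poly_roots _ _ s nz; rewrite size_map size_iota ltnn.
have N0 : 0 < N.+1%:R :> R by rewrite ltr0n.
have ba : 0 < b - a by rewrite subr_gt0.
case/(_ _ _)/notF; last first.
  rewrite map_inj_uniq ?iota_uniq // => k l /addrI.
  move/(mulfI (lt0r_neq0 ba)) /(divIf (lt0r_neq0 N0)) /eqP.
  by rewrite eqr_nat => /eqP.
apply/allP => u /mapP[k]; rewrite mem_iota => kN ->.
rewrite rootE !hornerE pr ?subrr //.
rewrite lerDl divr_ge0 ?mulr_ge0 ?ler0n ?(ltW ba) //=.
rewrite -ltrBrDl -[ltRHS]mulr1 -mulrA ltr_pM2l // ltr_pdivrMr // mul1r ltr_nat.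
by lia.
Qed.

(** * Counting the entries of the extended partitions *)

Section Knots.
Variables (R : realType) (S : mdspline R).

Local Notation q := (nknots S).
Local Notation m := (max_deg S).

Definition tcount j := (\sum_(1 <= l < j.+1) (deg S l.-1 - cont S l))%N.

Local Notation nu := tcount.
Local Notation mu := (scount (deg S) nu).
Local Notation active := (in_supp m (deg S) nu).

Lemma tcountS j : nu j.+1 = (nu j + (deg S j - cont S j.+1))%N.
Proof. by rewrite /tcount big_nat_recr. Qed.

Lemma tcount0 : nu 0%N = 0%N.
Proof. by rewrite /tcount big_geq. Qed.

Lemma cont_bounds j : (j < q)%N ->
  (cont S j.+1 <= deg S j)%N /\ (cont S j.+1 <= deg S j.+1)%N.
Proof.
by move=> jq; have := @cont_le R S j.+1 jq; rewrite leq_min => /andP[].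
Qed.

Lemma scount_sum j : (j <= q)%N ->
  mu j = ((deg S 0).+1 + \sum_(1 <= l < j.+1) (deg S l - cont S l))%N.
Proof.
elim: j => [|j IH] jq; first by rewrite /scount tcount0 big_geq ?addn0.
rewrite big_nat_recr //= addnA -IH ?(ltnW jq) // /scount tcountS.
by have := cont_bounds jq; lia.
Qed.

Lemma scount_dim : mu q = md_dim S.
Proof. by rewrite scount_sum. Qed.

Lemma tcount_smooth j : (j < q)%N -> (nu j.+1 < mu j)%N.
Proof. by rewrite /scount tcountS; lia. Qed.

Lemma tcount_valid : valid_counts q (deg S) nu.
Proof.
move=> j jq; have := tcount_smooth jq; have := cont_bounds jq.
by rewrite /scount tcountS; split; lia.
Qed.

Lemma deg_le_max j : (j <= q)%N -> (deg S j <= m)%N.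
Proof.
move=> jq.
exact: (@leq_bigmax _ (fun l : 'I_q.+1 => deg S l) (Ordinal (jq : j < q.+1)%N)).
Qed.

Lemma bp_homo i j : (i < j)%N -> (j <= q.+1)%N -> bp S i < bp S j.
Proof.
elim: j => // j IH; rewrite ltnS leq_eqVlt => /predU1P[->|ij] jq.
  exact: bp_lt.
exact: lt_trans (IH ij (ltnW jq)) (bp_lt _).
Qed.

Lemma bp_leE i j : (i <= q.+1)%N -> (j <= q.+1)%N ->
  (bp S i <= bp S j) = (i <= j)%N.
Proof.
move=> iq jq; have [|ji|->] := ltngtP i j; last exact: lexx.
  by move=> ij; rewrite ltW // bp_homo.
by rewrite leNgt bp_homo.
Qed.

Lemma bp_ltE i j : (i <= q.+1)%N -> (j <= q.+1)%N ->
  (bp S i < bp S j) = (i < j)%N.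
Proof. by move=> iq jq; rewrite ltNge bp_leE // -ltnNge. Qed.

(** The longer end block of each partition is absorbed into the multiplicities, so that
    [nth_flatten_nseq] applies to the whole list. *)
Definition left_mult l :=
  if l is 0 then (deg S 0).+1 else (deg S l - cont S l)%N.

Definition right_mult l :=
  if l == q.+1 then (deg S q).+1 else (deg S l.-1 - cont S l)%N.

Lemma left_partitionE : left_partition S =
  flatten [seq nseq (left_mult l) (bp S l) | l <- iota 0 q.+1].
Proof.
pose F l := nseq (left_mult l) (bp S l).
rewrite /left_partition (_ : map _ _ = map F (iota 1 q)) //.
by apply/eq_in_map => -[|l] //; rewrite mem_iota.
Qed.

Lemma right_partitionE : right_partition S =
  flatten [seq nseq (right_mult l) (bp S l) | l <- iota 1 q.+1].
Proof.
rewrite -[in iota 1 q.+1](addn1 q) iotaD map_cat flatten_cat /=.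
rewrite /right_mult eqxx cats0.
congr (flatten _ ++ _); apply/eq_in_map => l; rewrite mem_iota => lq.
by rewrite ifF //; lia.
Qed.

Lemma sum_left j : (j <= q)%N ->
  (\sum_(0 <= l < j.+1) left_mult l)%N = mu j.
Proof.
move=> jq; rewrite scount_sum // big_nat_recl // big_add1.
by congr (_ + _)%N; rewrite big_add1.
Qed.

Lemma sum_right j : (j <= q)%N ->
  (\sum_(1 <= l < j.+1) right_mult l)%N = nu j.
Proof.
by move=> jq; apply: eq_big_nat => l lj; rewrite /right_mult ifF //; lia.
Qed.

Lemma spt_le i j : (j <= q)%N -> (spt S i <= bp S j) = (i <= mu j)%N.
Proof.
move=> jq; rewrite /spt left_partitionE.
rewrite (@nth_flatten_nseq _ (fun u => u <= bp S j) _ _ _ j.+1); first last.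
- by lia.
- by rewrite bp_leE //; lia.
- by move=> l lq; rewrite bp_leE //; lia.
by rewrite sum_left // /scount; lia.
Qed.

Lemma spt_lt i j : (j <= q)%N -> (spt S i < bp S j.+1) = (i <= mu j)%N.
Proof.
move=> jq; rewrite /spt left_partitionE.
rewrite (@nth_flatten_nseq _ (fun u => u < bp S j.+1) _ _ _ j.+1); first last.
- by lia.
- by rewrite bp_ltE //; lia.
- by move=> l lq; rewrite bp_ltE //; lia.
by rewrite sum_left // /scount; lia.
Qed.

Lemma spt_ge_left i : bp S 0 <= spt S i.
Proof.
rewrite leNgt /spt left_partitionE.
rewrite (@nth_flatten_nseq _ (fun u => u < bp S 0) _ _ _ 0); first last.
- by lia.
- by rewrite bp_ltE.
- by move=> l lq; rewrite bp_ltE //; lia.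
by rewrite big_geq.
Qed.

Lemma tpt_le i j : (j <= q)%N -> (tpt S i <= bp S j) = (i.-1 < nu j)%N.
Proof.
move=> jq; rewrite /tpt right_partitionE.
rewrite (@nth_flatten_nseq _ (fun u => u <= bp S j) _ _ _ j.+1); first last.
- by lia.
- by rewrite bp_leE //; lia.
- by move=> l lq; rewrite bp_leE //; lia.
by rewrite sum_right.
Qed.

Lemma tpt_ge i j : (j <= q)%N -> (bp S j.+1 <= tpt S i) = (nu j <= i.-1)%N.
Proof.
move=> jq; rewrite leNgt leqNgt /tpt right_partitionE; congr (~~ _).
rewrite (@nth_flatten_nseq _ (fun u => u < bp S j.+1) _ _ _ j.+1); first last.
- by lia.
- by rewrite bp_ltE //; lia.
- by move=> l lq; rewrite bp_ltE //; lia.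
by rewrite sum_right.
Qed.

Lemma in_supp_mdb n i j : (j <= q)%N ->
  [&& mdb_defined S n i, spt S i <= bp S j &
      bp S j.+1 <= tpt S (i + n - m)] = active n i j.
Proof.
move=> jq; rewrite /mdb_defined /in_supp spt_le // tpt_ge //.
apply/idP/idP => [/and3P[/and3P[? _ _] ? ?]|/andP[lt le]].
  by apply/andP; split; lia.
have ge : (nu j <= (i + n - m).-1)%N by lia.
have iK : (i <= md_dim S)%N.
  by rewrite -scount_dim (leq_trans le) // (scount_homo tcount_valid).
have st : spt S i < tpt S (i + n - m).
  apply: (@le_lt_trans _ _ (bp S j)); first by rewrite spt_le.
  by apply: (lt_le_trans (bp_lt jq)); rewrite tpt_ge.
by rewrite iK st le ge !andbT; lia.
Qed.

(** The least j with s_i <= x_j has s_i = x_j, as the entries of s are breakpoints. If s_i <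
    t_(i-m+n), that entry of t lies beyond x_j, hence at or beyond x_(j+1). *)
Lemma mdb_definedP n i :
  reflect (exists2 j, (j <= q)%N & active n i j) (mdb_defined S n i).
Proof.
apply: (iffP idP) => [/[dup] df /and3P[mi iK st]|[j jq]]; last first.
  by rewrite -in_supp_mdb // => /andP[].
have [|j imu min_j] := @ex_minnP (fun j => i <= mu j)%N.
  by exists q; rewrite scount_dim.
have jq : (j <= q)%N by apply: min_j; rewrite scount_dim.
exists j => //; rewrite -in_supp_mdb // df spt_le // imu /= tpt_ge //.
rewrite leqNgt -tpt_le // -ltNge (le_lt_trans _ st) //.
case: j => [|j] in imu min_j jq *; first exact: spt_ge_left.
rewrite leNgt spt_lt; last exact: ltnW.
by apply/negP => /min_j; rewrite ltnn.
Qed.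

End Knots.

(** * Agreement of the recurrence with the polynomial model *)

Section Link.
Variables (R : realType) (S : mdspline R).

Local Notation q := (nknots S).
Local Notation m := (max_deg S).
Local Notation nu := (tcount S).
Local Notation mu := (scount (deg S) nu).
Local Notation active := (in_supp m (deg S) nu).
Local Notation cdf := (basis_cdf q m (bp S) (deg S) nu).
Local Notation piece := (basis_piece q m (bp S) (deg S) nu).
Local Notation integral := (basis_integral q m (bp S) (deg S) nu).
Local Notation b := (right_end S).

Let valid_nu := @tcount_valid _ S.
Let bp_increasing : forall j, (j <= q)%N -> bp S j < bp S j.+1.
Proof. exact: bp_lt. Qed.

Let positive_integral n i j : (n <= m)%N -> (j <= q)%N -> active n i j ->
  0 < integral n i.
Proof.
exact: basis_integral_gt0 (@deg_le_max _ S) bp_increasing valid_nu _ _ _.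
Qed.

Definition glued (f : R -> R) (F : nat -> {poly R}) :=
  [/\ forall u, u < bp S 0 -> f u = 0,
      forall j u, (j <= q)%N -> bp S j <= u < bp S j.+1 -> f u = (F j).[u],
      forall u, b < u -> f u = 0 & f b = (F q).[b]].

Lemma glued_extend_left (f : R -> R) F :
  (forall u, u < bp S 0 -> f u = 0) ->
  (forall j u, (j <= q)%N -> bp S j <= u < bp S j.+1 -> f u = (F j).[u]) ->
  (forall u, b < u -> f u = 0) -> glued (extend_left b f) F.
Proof.
move=> f0 fF f1; rewrite /extend_left; split=> [u u0|j u jq ju|u bu|].
- by rewrite lt_eqF ?f0 // (lt_trans u0) // bp_homo.
- rewrite lt_eqF; first exact: fF.
  by case/andP: ju => _ /lt_le_trans; apply; rewrite bp_leE.
- by rewrite gt_eqF ?f1.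
rewrite eqxx; apply: cvg_lim => //.
have Fb : horner (F q) u @[u --> b^'-] --> (F q).[b].
  by apply: cvg_at_left_filter; exact: continuous_horner.
apply: cvg_trans Fb; apply: near_eq_cvg; near=> u.
rewrite (fF q) //; apply/andP; split; near: u.
  by apply: nbhs_left_ge; exact: bp_lt.
exact: nbhs_left_lt.
Unshelve. all: by end_near. Qed.

Lemma interval_unique j l (u : R) : (j <= q)%N -> (l <= q)%N ->
  bp S j <= u < bp S j.+1 -> bp S l <= u < bp S l.+1 -> l = j.
Proof.
have le i k : (i <= q)%N -> (k <= q)%N -> bp S i <= u -> u < bp S k.+1 ->
    (i <= k)%N.
  move=> iq kq iu uk.
  by rewrite -ltnS -(@bp_ltE _ S) ?(le_lt_trans iu uk) // leqW.
move=> jq lq /andP[ju uj] /andP[lu ul].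
by apply/eqP; rewrite eqn_leq (le _ _ lq jq lu uj) (le _ _ jq lq ju ul).
Qed.

Lemma mdb_piece_in n G i j u : (j <= q)%N -> bp S j <= u < bp S j.+1 ->
  mdb_piece S n G i u =
  if active n i j then
    if n == (m - deg S j)%N then 1
    else if (m - deg S j < n)%N then G i u - G i.+1 u else 0
  else 0.
Proof.
move=> jq ju; rewrite /mdb_piece.
case: pickP => [l lu|/(_ (Ordinal (jq : j < q.+1)%N))].
  have lq : (l <= q)%N by rewrite -ltnS.
  by rewrite (interval_unique jq lq ju lu) in_supp_mdb.
by rewrite /= ju.
Qed.

Lemma mdb_piece_out n G i u : (u < bp S 0) || (b <= u) ->
  mdb_piece S n G i u = 0.
Proof.
move=> u_out; rewrite /mdb_piece; case: pickP => // l /andP[lu ul].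
have lq : (l <= q)%N by rewrite -ltnS.
case/orP: u_out => [u0|bu].
  by move: (le_lt_trans lu u0); rewrite bp_ltE // leqW.
by move: (le_lt_trans bu ul); rewrite bp_ltE // ltnS ltnNge lq.
Qed.

Lemma glued_mdb_piece n G i : (n <= m)%N ->
  (forall k j u, (0 < n)%N -> (j <= q)%N -> bp S j <= u < bp S j.+1 ->
    G k u = (cdf n k j).[u]) ->
  glued (extend_left b (mdb_piece S n G i)) (piece n i).
Proof.
move=> nm GE; apply: glued_extend_left => [u u0|j u jq ju|u bu].
- by rewrite mdb_piece_out ?u0.
- rewrite (mdb_piece_in _ _ _ jq ju).
  have [act|inact] := boolP (active n i j); last first.
    by rewrite basis_piece_support ?horner0.
  have dm := deg_le_max jq; have /andP[act1 act2] := act.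
  (* At n = m - d_j the only active index is i = mu j, where the cdfs of i and i.+1 are 1 and 0;
     this matches the clause N_(i,n) = 1. *)
  rewrite /basis_piece; have [nE|nE] := eqVneq n (m - deg S j)%N.
    rewrite ifT; last by lia.
    rewrite (basis_cdf_eq1 _ valid_nu) // ?(basis_cdf_eq0 _ _ valid_nu) //
      ?subr0 ?hornerC //.
      by move: act1; rewrite nE /scount; lia.
    by move: act2; rewrite nE /scount; lia.
  have lt : (m - deg S j < n)%N by move: act1 act2 nE; rewrite /scount; lia.
  rewrite lt ifT; last by lia.
  have n0 : (0 < n)%N by exact: leq_ltn_trans lt.
  by rewrite !(GE _ j) // hornerD hornerN.
- by rewrite mdb_piece_out // (ltW bu) orbT.
Qed.

Lemma glued_integral f F : glued f F ->
  \int[lebesgue_measure]_u f u = total_mass q (bp S) F.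
Proof. by case=> f0 fF f1 _; exact: piecewise_integral_total. Qed.

Lemma glued_integral_itv f F : glued f F ->
  \int[lebesgue_measure]_(u in `[left_end S, b]) f u = total_mass q (bp S) F.
Proof. by case=> f0 fF f1 _; exact: piecewise_integral_itv. Qed.

(** Positivity makes the zero test in [basis_cdf] agree with [mdb_defined]. An undefined function
    has empty support, and both sides are the step at s_i. *)
Lemma mdb_cumulE n f i j u : (n <= m)%N -> glued (f i) (piece n i) ->
  (j <= q)%N -> bp S j <= u < bp S j.+1 ->
  mdb_cumul S n f i u = (cdf n.+1 i j).[u].
Proof.
move=> nm fi jq ju; rewrite /mdb_cumul basis_cdfS.
case: (boolP (mdb_defined S n i)) =>
  [/mdb_definedP[l lq act]|/mdb_definedP undef].
  rewrite gt_eqF ?(positive_integral nm lq act) // /mdb_delta.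
  rewrite (glued_integral fi) -/(integral n i).
  case: fi => f0 fF f1 _; set c := (integral n i)^-1.
  rewrite (@piecewise_integral _ q (bp S) _ (fun l => c *: piece n i l)
    _ _ _ j) //.
  - rewrite (@cumul_lincomb _ (bp S) c 0 (piece n i) (piece n i)) => [|k _].
      by rewrite scale0r addr0.
    by rewrite scale0r addr0.
  - by move=> v v0; rewrite f0 ?mulr0.
  - by move=> k v kq kv; rewrite (fF k) // hornerZ.
  - by case/andP: ju => -> /ltW.
rewrite (basis_integral_eq0 _ valid_nu) ?eqxx; last first.
  by move=> l lq; apply/negP => act; apply: undef; exists l.
rewrite hornerMn hornerC; case: (leqP i (mu j)) => imu.
  by rewrite (le_trans _ (proj1 (andP ju))) // spt_le.
by rewrite leNgt (lt_le_trans (proj2 (andP ju))) // leNgt spt_lt // -ltnNge.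
Qed.

Lemma mdb_glued n i : (n <= m)%N -> glued (mdb S n i) (piece n i).
Proof.
elim: n i => [|n IH] i nm; apply: glued_mdb_piece => // k j u _ jq ju.
by apply: mdb_cumulE => //; [exact: ltnW|exact/IH/ltnW].
Qed.

End Link.

(** The N_(i,m-1) vanish on intervals of degree zero, so their integrals miss the length of such an
    interval; hence the second half lets no interval of positive degree follow one of degree zero.
    In the first half d_0 >= 1 places a itself under the Greville condition, which yields xi_1 =
    a. *)
Theorem proposition2 (R : realType) (S : mdspline R) :
  ((1 <= deg S 0)%N ->
   forall xi : nat -> R, greville_abscissae S xi ->
   forall i : nat, (1 <= i <= md_dim S)%N ->
     xi i = left_end S + \sum_(1 <= j < i)
       \int[lebesgue_measure]_(x in `[left_end S, right_end S])
         mdb_deriv_basis S j x)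
  /\
  ((forall l j : nat, (l <= j <= nknots S)%N ->
      (1 <= deg S j)%N -> (1 <= deg S l)%N) ->
   greville_abscissae S (fun i : nat =>
     left_end S + \sum_(1 <= j < i)
       \int[lebesgue_measure]_(x in `[left_end S, right_end S])
         mdb_deriv_basis S j x)).
Proof.
set q := nknots S; set m := max_deg S.
pose N := basis_piece q m (bp S) (deg S) (tcount S).
pose I := basis_integral q m (bp S) (deg S) (tcount S).
pose xi i := left_end S + \sum_(1 <= j < i)
  \int[lebesgue_measure]_(x in `[left_end S, right_end S])
    mdb_deriv_basis S j x.
have d_le := @deg_le_max _ S.
have valid_nu := @tcount_valid _ S.
have basis i : glued S (mdb_basis S i) (N m i) by exact: mdb_glued.
have dbasis j : \int[lebesgue_measure]_(x in `[left_end S, right_end S])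
    mdb_deriv_basis S j x = I m.-1 j.+1.
  by apply/glued_integral_itv/mdb_glued/leq_pred.
(* This reconciles sums from 0 in the polynomial model with sums from 1. *)
have N0 j n : (j <= q)%N -> (n <= m)%N -> N n 0%N j = 0.
  by move=> jq nm; apply: basis_piece_support => //; rewrite /in_supp; lia.
have xiS i : (0 < m)%N -> (0 < i)%N -> xi i = xi i.-1 + I m.-1 i.
  case: i => [|[|i]] // m0 _; rewrite /xi.
    (* For i = 1 both values are a: N_(1,m-1) is undefined and its integral is 0. *)
    rewrite !big_geq // /I basis_integral_eq0 ?addr0 // => j jq.
    by rewrite /in_supp; lia.
  by rewrite big_nat_recr //= dbasis addrA.
split=> [d0 c cG i iK|d_init j jq dj x xj].
- have m0 : (0 < m)%N by exact: leq_trans d0 (d_le 0%N _).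
  have [] := @greville_unique R q m (bp S) (deg S) (tcount S) d_le (@bp_lt _ S)
    valid_nu m0 (tcount0 S) (@tcount_smooth _ S) c d0.
    move=> j jq dj; apply: (@poly_eq_on_itv _ _ _ (bp S j) (bp S j.+1)).
      exact: bp_lt.
    move=> u ju; rewrite hornerX -[RHS](cG j) //; last first.
      by case/andP: ju => -> /ltW.
    rewrite horner_sum scount_dim big_nat_recl // [X in _ *: X](N0 j m) //.
    rewrite scaler0 horner0 add0r big_add1; apply: eq_bigr => k _.
    by rewrite hornerZ; case: (basis k.+1) => _ /(_ j u jq ju) -> _ _.
  rewrite scount_dim => c1 cS; rewrite -/(xi i).
  elim: i iK => // -[|i] IH iK.
    by rewrite c1 /xi big_geq // addr0.
  by rewrite cS // IH ?(xiS i.+2) //; lia.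
rewrite -/(xi _).
have m0 : (0 < m)%N by exact: leq_trans dj (d_le j jq).
(* Pieces are half-open: at the right end of [x_j, x_(j+1)] with j < q the values come from piece
   j.+1, whose degree may be zero. *)
have [j' [jq' d_lt xj' Nx]] : exists j', [/\ (j' <= q)%N,
    forall l, (l < j')%N -> (0 < deg S l)%N,
    (0 < deg S j')%N || (x == bp S j') &
    forall i, mdb_basis S i x = (N m i j').[x]].
  have d_lt l : (l <= j)%N -> (0 < deg S l)%N.
    by move=> lj; apply: (d_init l j) => //; rewrite lj.
  case/andP: xj => jx; rewrite le_eqVlt => /predU1P[xE|xj]; last first.
    exists j; split=> // [l lj||i]; first exact/d_lt/ltnW.
      by rewrite dj.
    by case: (basis i) => _ /(_ j x jq) -> //; rewrite jx.
  move: jq; rewrite leq_eqVlt => /predU1P[jq|jq].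
    exists j; split=> // [|l lj||i]; first by rewrite jq.
    - exact/d_lt/ltnW.
    - by rewrite dj.
    by rewrite xE jq; case: (basis i).
  exists j.+1; split=> // [|i]; first by rewrite xE eqxx orbT.
  case: (basis i) => _ /(_ j.+1 x jq) -> //.
  by rewrite xE lexx bp_lt.
rewrite -[RHS](@sum_greville_piece R q m (bp S) (deg S) (tcount S) d_le
  (@bp_lt _ S) valid_nu m0 xi j' x) //; last first.
- by move=> i i0; exact: xiS.
- by rewrite /xi big_geq // addr0.
rewrite scount_dim [RHS]big_nat_recl // [basis_piece _ _ _ _ _ m 0%N _]N0 //.
rewrite horner0 mulr0 add0r big_add1.
by apply: eq_bigr => i _; rewrite Nx.
Qed.
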